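(* Let $(\kappa,k_1,k_2)\in\mathcal{L}_1^1$ and $n\in\mathbb{N}$. Then the $n$-fold sequential 1st level GFD is a left-inverse operator to the $n$-fold GFI on the space $\mathbb{I}_{(k_1)}(C_{-1}(0,+\infty))$, i.e., for every $f\in \mathbb{I}_{(k_1)}(C_{-1}(0,+\infty))$, $$({}_{1L}\mathbb{D}_{(k_1,k_2)}^{<n>}\,\mathbb{I}_{(\kappa)}^{<n>}\,f)(t)=f(t),\quad t>0.$$
   Context: $C_{-1}(0,+\infty)$ is the space of functions $f$ on $(0,+\infty)$ of the form $f(t)=t^{p}f_1(t)$, $t>0$, with some $p>-1$ and $f_1\in C[0,+\infty)$. The symbol $*$ denotes the Laplace convolution $(f*g)(t)=\int_0^t f(t-\tau)g(\tau)\,d\tau$, $t>0$. $\mathcal{L}_1^1$ is the set of triples $(\kappa,k_1,k_2)$ of real-valued functions belonging to $C_{-1}(0,+\infty)$ with $(\kappa*k_1*k_2)(t)=1$ for all $t>0$ (1st level kernels). For $k\in C_{-1}(0,+\infty)$, the general fractional integral (GFI) is $(\mathbb{I}_{(k)}f)(t)=(k*f)(t)$, $t>0$, and $\mathbb{I}_{(k)}(C_{-1}(0,+\infty))=\{f:\ f=\mathbb{I}_{(k)}\phi,\ \phi\in C_{-1}(0,+\infty)\}$. The 1st level general fractional derivative (1st level GFD) with kernels $(k_1,k_2)$ is $({}_{1L}\mathbb{D}_{(k_1,k_2)}f)(t)=\left(\mathbb{I}_{(k_1)}\frac{d}{dt}\mathbb{I}_{(k_2)}f\right)(t)$. The $n$-fold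 GFI $\mathbb{I}_{(\kappa)}^{<n>}$ is the $n$-fold composition of $\mathbb{I}_{(\kappa)}$ with itself, and the $n$-fold sequential 1st level GFD ${}_{1L}\mathbb{D}_{(k_1,k_2)}^{<n>}$ is the $n$-fold composition of ${}_{1L}\mathbb{D}_{(k_1,k_2)}$ with itself. *)

(* Defs.v *)
From mathcomp Require Import all_boot all_order all_algebra.
From mathcomp Require Import all_classical all_reals all_analysis.
Import Order.TTheory GRing.Theory Num.Theory.
Import numFieldNormedType.Exports.

Set Implicit Arguments.
Unset Strict Implicit.
Unset Printing Implicit Defensive.

Local Open Scope classical_set_scope.
Local Open Scope ring_scope.

(** A function on the open half-line (0, +oo) is encoded as a total function
    [R -> R] of which only the values at [t > 0] are ever relevant: the
    operators below, evaluated at [t > 0], depend only on the values of their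
    arguments on (0, +oo), and identities between functions are only stated at
    [t > 0]. *)

Definition Cm1 (R : realType) : set (R -> R) :=
  [set f | exists p : R, exists f1 : R -> R,
    [/\ -1 < p, {within `[0, +oo[, continuous f1} &
        forall t : R, 0 < t -> f t = t `^ p * f1 t]].

Definition conv (R : realType) (f g : R -> R) (t : R) : R :=
  \int[lebesgue_measure]_(tau in `]0, t[) (f (t - tau) * g tau).

(** [conv] is total, with an unspecified value when the integral does not
    exist; [conv_exists f g] says that it is a genuine (absolutely convergent)
    integral at every [t > 0]. *)
Definition conv_exists (R : realType) (f g : R -> R) : Prop :=
  forall t : R, 0 < t ->
    lebesgue_measure.-integrable `]0, t[
      (fun tau : R => (f (t - tau) * g tau)%:E).

Definition first_level_kernels (R : realType) : set ((R -> R) * (R -> R) * (R -> R)) :=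
  [set K | let: (kappa, k1, k2) := K in
    [/\ Cm1 kappa, Cm1 k1, Cm1 k2 &
        forall t : R, 0 < t -> conv (conv kappa k1) k2 t = 1]].

Definition gfi (R : realType) (k f : R -> R) : R -> R := conv k f.

Definition gfi_range (R : realType) (k : R -> R) : set (R -> R) :=
  [set f | exists2 phi : R -> R, Cm1 phi &
    forall t : R, 0 < t -> f t = gfi k phi t].

Definition gfd1 (R : realType) (k1 k2 f : R -> R) : R -> R :=
  gfi k1 (derive1 (gfi k2 f)).

(** [f] is in the domain of the total operator [gfd1 k1 k2]: both integrals
    converge and the derivative between them exists, everywhere on (0, +oo). *)
Definition gfd1_exists (R : realType) (k1 k2 f : R -> R) : Prop :=
  [/\ conv_exists k2 f,
      forall t : R, 0 < t -> derivable (gfi k2 f) t 1 &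
      conv_exists k1 (derive1 (gfi k2 f))].

Definition gfi_iter (R : realType) (k : R -> R) (n : nat) (f : R -> R) : R -> R :=
  iter n (gfi k) f.

Definition gfd1_iter (R : realType) (k1 k2 : R -> R) (n : nat) (f : R -> R) :
    R -> R :=
  iter n (gfd1 k1 k2) f.

(* Main.v *)
(** The class of functions vanishing on ]-oo, 0], continuous on ]0, +oo[ and
    integrable on every ]0, T[ contains the extension by zero of every element
    of C_{-1}, and its closure under convolution needs no Beta integrals, only
    Tonelli and dominated convergence. In it the convolution is commutative and
    associative (Tonelli and Fubini). The range hypothesis gives f = k1 * phi,
    so the j-fold GFI of f is k1 * psi_j with psi_j = kappa * ... * kappa * phi,
    and since k2 * (k1 * psi_(j+1)) = (kappa * k1 * k2) * psi_j = 1 * psi_j is a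
    primitive of the continuous function psi_j, one GFD takes k1 * psi_(j+1)
    back to k1 * psi_j. *)
Require Import Defs.
From mathcomp Require Import all_boot all_order all_algebra.
From mathcomp Require Import all_classical all_reals all_analysis.
From mathcomp Require Import measurable_realfun ring lra.
Import Order.TTheory GRing.Theory Num.Theory.
Import numFieldNormedType.Exports.

Local Open Scope classical_set_scope.
Local Open Scope ring_scope.

(* [convex] exports another [conv]. *)
Local Notation conv := Defs.conv.

Section convolution.
Context {R : realType}.
Notation mu := (@lebesgue_measure R).
Implicit Types (f g h F : R -> R) (c t T : R).

(** * Reflections and translations of the line preserve Lebesgue integrals *)

Lemma measurable_reflect c : measurable_fun [set: R] (fun x => c - x).
Proof. exact: measurable_funB. Qed.

(** Uniqueness of the measure reduces this to half-open intervals: the preimage of []a, b]] is [[c -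
    b, c - a[], of the same length. *)
Lemma lebesgue_measure_reflect c (A : set R) : measurable A ->
  mu A =
  pushforward mu (fun x : measurableTypeR R => c - x : measurableTypeR R) A.
Proof.
move=> mA.
pose nu : {measure set (measurableTypeR R) -> \bar R} :=
  measure_function_pushforward__canonical__measure_function_Measure
    (T2 := measurableTypeR R) mu (measurable_reflect c).
suff H : forall X : set R, ocitv X -> mu X = nu X.
  exact: (lebesgue_measure_unique H).
move=> X /ocitvP[->|[[a b] /= ab ->]].
  by rewrite !measure0.
rewrite /= /pushforward.
rewrite (_ : _ @^-1` _ = `[c - b, c - a[%classic); last first.
  apply/seteqP; split => x /=; rewrite !in_itv/= => /andP[? ?];
    apply/andP; split; lra.
rewrite !lebesgue_measure_itv/= !lte_fin.
by rewrite ltrD2l ltrN2; case: ifP => // _; rewrite -!EFinB; congr EFin; lra.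
Qed.

Lemma ge0_integral_reflect c (F : R -> \bar R) : measurable_fun setT F ->
  (forall x, 0 <= F x)%E ->
  (\int[mu]_x F (c - x)%R = \int[mu]_x F x)%E.
Proof.
move=> mF F0.
have := @ge0_integral_pushforward _ _ (measurableTypeR R) (measurableTypeR R) R
  (fun x => c - x) (measurable_reflect c) mu setT F measurableT mF.
rewrite preimage_setT => <-//; apply: eq_measure_integral => [|mr A mA _].
  exact: measurable_reflect.
exact: esym (lebesgue_measure_reflect c A mA).
Qed.

Lemma integral_reflect c (F : R -> \bar R) : measurable_fun setT F ->
  (\int[mu]_x F (c - x)%R = \int[mu]_x F x)%E.
Proof.
move=> mF; rewrite [LHS]integralE [RHS]integralE.
congr (_ - _)%E.
  rewrite [X in integral _ _ X](funepos_comp F (fun x => c - x)).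
  apply: (ge0_integral_reflect c (F^\+)%E (measurable_funepos mF)).
  exact: funepos_ge0.
rewrite [X in integral _ _ X](funeneg_comp F (fun x => c - x)).
apply: (ge0_integral_reflect c (F^\-)%E (measurable_funeneg mF)).
exact: funeneg_ge0.
Qed.

Lemma integrable_reflect c (F : R -> \bar R) :
  mu.-integrable setT F -> mu.-integrable setT (fun x => F (c - x)).
Proof.
move=> /integrableP[mF Foo]; apply/integrableP; split.
  by apply: (measurableT_comp mF); exact: measurable_reflect.
rewrite (integral_reflect c (abse \o F))//; exact: measurableT_comp.
Qed.

(** A translation is a composite of two reflections: [x - c = 0 - (c - x)]. *)
Lemma integral_shift c (F : R -> \bar R) : measurable_fun setT F ->
  (\int[mu]_x F (x - c)%R = \int[mu]_x F x)%E.
Proof.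
move=> mF; rewrite -(integral_reflect 0 F)//.
rewrite -[RHS](integral_reflect c (fun x => F (0 - x))).
  by apply: eq_integral => x _; rewrite sub0r opprB.
by apply: (measurableT_comp mF); exact: measurable_reflect.
Qed.

(** * Integrals with a continuous moving kernel, and a cutoff function *)

Lemma continuous_segment_bounded (h : R -> R) (c d : R) :
  (forall x, c <= x <= d -> {for x, continuous h}) ->
  exists2 M, 0 < M & forall x, c <= x <= d -> `|h x| <= M.
Proof.
move=> ch.
have wh : {within `[c, d], continuous h}.
  by apply: continuous_in_subspaceT => x /[!inE]/=; rewrite in_itv/=; exact: ch.
have /compact_bounded[M [_ hM]] :=
  continuous_compact wh (@segment_compact R c d).
exists (`|M| + 1); first by rewrite ltr_wpDl.
move=> x xcd; apply: (hM (`|M| + 1)).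
  by rewrite (le_lt_trans (ler_norm M))// ltrDl.
by exists x => //=; rewrite in_itv.
Qed.

Lemma continuous_reflect (h : R -> R) (x s : R) :
  {for x - s, continuous h} -> {for s, continuous (fun s => h (x - s))}.
Proof.
move=> ch; apply: (@continuous_comp _ _ _ (fun s : R => x - s) h) => //.
by apply: continuousB; [exact: cst_continuous | exact: cvg_id].
Qed.

Lemma continuous_translate (h : R -> R) (x s : R) :
  {for x - s, continuous h} -> {for x, continuous (fun x => h (x - s))}.
Proof.
move=> ch; apply: (@continuous_comp _ _ _ (fun x : R => x - s) h) => //.
by apply: continuousB; [exact: cvg_id | exact: cst_continuous].
Qed.

(** For [s] in []0, b[] the argument [x - s] stays in a segment on which [h] is bounded, so the
    integrand is bounded times integrable. *)
Lemma moving_kernel_integrable (h v : R -> R) (x b : R) :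
  (forall y, x - b <= y <= x -> {for y, continuous h}) ->
  mu.-integrable `]0, b[ (EFin \o v) ->
  mu.-integrable `]0, b[ (fun s => (h (x - s) * v s)%:E).
Proof.
move=> ch iv; have [M M0 hM] := continuous_segment_bounded h _ _ ch.
apply: (@integrableMr _ _ _ mu `]0, b[ _ (fun s => h (x - s)) (EFin \o v)) =>
  //.
  apply: open_continuous_measurable_fun => // s /[!inE]/=.
  rewrite in_itv/= => sb.
  by apply: continuous_reflect; apply: ch; lra.
exists M; split; first exact: num_real.
move=> N MN s /=; rewrite in_itv/= => sb.
by apply: (le_trans _ (ltW MN)); apply: hM; lra.
Qed.

(** Dominated convergence with majorant [M * |v|], where [M] bounds [h] on [[u - b, w]], a segment
    containing every [x - s] that occurs. *)
Lemma moving_kernel_continuous (h v : R -> R) (u w b : R) :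
  (forall y, u - b <= y <= w -> {for y, continuous h}) ->
  mu.-integrable `]0, b[ (EFin \o v) ->
  forall x, u < x < w ->
  {for x, continuous (fun x => \int[mu]_(s in `]0, b[) (h (x - s) * v s))}.
Proof.
move=> ch iv x xuw; have [M M0 hM] := continuous_segment_bounded h _ _ ch.
apply: (@continuity_under_integral R _ _ mu (fun x s => h (x - s) * v s) `]0, b[
   _ u w _ _ (fun s => M * `|v s|)) => //.
- move=> y /=; rewrite in_itv/= => yuw.
  by apply: moving_kernel_integrable => // z zy; apply: ch; lra.
- apply: aeW => s /=; rewrite in_itv/= => sb y /[!inE]/=.
  rewrite in_itv/= => yuw.
  apply: continuousM; last exact: cst_continuous.
  by apply: continuous_translate; apply: ch; lra.
- rewrite [X in integrable _ _ X](_ : _ = fun s => (M%:E * (`|v s|%R)%:E)%E)//.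
  by apply: integrableZl => //; exact: integrable_norm.
- move=> y /=; rewrite in_itv/= => yuw.
  apply: aeW => s /=; rewrite in_itv/= => sb.
  by rewrite normrM ler_wpM2r//; apply: hM; lra.
- by rewrite inE/= in_itv.
Qed.

(** The ramp [2 - (2 / a) * x], clamped to [[0, 1]], reaches 1 at [a / 2] and 0 at [a]. *)
Lemma continuous_cutoff (a : R) : 0 < a ->
  exists chi : R -> R, [/\ continuous chi,
    forall x, x <= a / 2 -> chi x = 1 & forall x, a <= x -> chi x = 0].
Proof.
move=> a0; exists (fun x => Num.min 1 (Num.max 0 (2 - (2 / a) * x))); split.
- move=> x.
  apply: (@continuous_min R R (cst 1) (fun x => Num.max 0 (2 - (2 / a) * x))).
    exact: cst_continuous.
  apply: (@continuous_max R R (cst 0) (fun x => 2 - (2 / a) * x)).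
    exact: cst_continuous.
  apply: continuousB; first exact: cst_continuous.
  by apply: continuousM; [exact: cst_continuous | exact: cvg_id].
- move=> x xa; rewrite min_l// le_max; apply/orP; right.
  suff : 2 / a * x <= 1 by lra.
  by rewrite mulrAC ler_pdivrMr// mul1r; lra.
- move=> x ax; rewrite max_l ?min_r//.
  suff : 2 <= 2 / a * x by lra.
  by rewrite mulrAC ler_pdivlMr//; lra.
Qed.

(** * Supports, causal functions and commutativity of the convolution *)

Lemma patch_support F (D : set R) : (forall x, ~ D x -> F x = 0) -> F \_ D = F.
Proof.
move=> F0; apply/funext => x; rewrite patchE; case: ifPn => // /negP xD.
by rewrite F0// => Dx; apply: xD; rewrite inE.
Qed.

Lemma integrable_support F (D : set R) : measurable D ->
  (forall x, ~ D x -> F x = 0) ->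
  mu.-integrable D (EFin \o F) <-> mu.-integrable setT (EFin \o F).
Proof.
move=> mD F0; rewrite -[in X in _ <-> X](patch_support F D F0) -restrict_EFin.
exact: integrable_mkcond.
Qed.

Lemma Rintegral_support F (D : set R) : (forall x, ~ D x -> F x = 0) ->
  \int[mu]_(x in D) F x = \int[mu]_x F x.
Proof. by move=> F0; rewrite Rintegral_mkcond patch_support. Qed.

Definition causal f :=
  [/\ forall t, t <= 0 -> f t = 0, forall t, 0 < t -> {for t, continuous f} &
      forall T, mu.-integrable `]0, T[ (EFin \o f)].

Lemma causal_measurable f : causal f -> measurable_fun setT f.
Proof.
move=> [f0 cf _]; rewrite -(patch_support f `]0, +oo[); last first.
  by move=> x /=; rewrite in_itv/= andbT => /negP; rewrite -leNgt; exact: f0.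
apply/(measurable_restrictT f) => //.
apply: open_continuous_measurable_fun => // x /[!inE]/=.
by rewrite in_itv/= andbT; exact: cf.
Qed.

Lemma mul_reflect_support f g t :
  (forall s, s <= 0 -> f s = 0) -> (forall s, s <= 0 -> g s = 0) ->
  forall b, t <= b -> forall s, ~ `]0, b[%classic s -> f (t - s) * g s = 0.
Proof.
move=> f0 g0 b tb s /=; rewrite in_itv/= => /negP; rewrite negb_and -!leNgt.
by move=> /orP[/g0 ->|bs]; rewrite ?mulr0// f0 ?mul0r//; lra.
Qed.

(** On the whole line the domain of integration no longer depends on [t], so that reflections and
    Fubini apply directly. *)
Lemma conv_setT f g t :
  (forall s, s <= 0 -> f s = 0) -> (forall s, s <= 0 -> g s = 0) ->
  conv f g t = \int[mu]_s (f (t - s) * g s).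
Proof.
move=> f0 g0; rewrite /conv Rintegral_support// => s.
exact: mul_reflect_support.
Qed.

Lemma conv_le0 f g t : t <= 0 -> conv f g t = 0.
Proof.
move=> t0; rewrite /conv set_itv_ge ?Rintegral_set0//.
by rewrite bnd_simp -leNgt.
Qed.

Lemma measurable_mul_reflect f g t :
  measurable_fun setT f -> measurable_fun setT g ->
  measurable_fun setT (fun s : R => f (t - s) * g s).
Proof.
move=> mf mg; apply: measurable_funM => //.
by apply: (measurableT_comp mf); exact: measurable_reflect.
Qed.

(** The substitution [s -> t - s] exchanges the two factors. *)
Lemma conv_comm f g : causal f -> causal g -> conv f g = conv g f.
Proof.
move=> cf cg; apply/funext => t; have [f0 _ _] := cf; have [g0 _ _] := cg.
rewrite !conv_setT// /Rintegral; congr fine.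
rewrite -(integral_reflect t).
  by apply: eq_integral => s _; rewrite subKr mulrC.
apply/measurable_EFinP.
by apply: measurable_mul_reflect; exact: causal_measurable.
Qed.

(* [fs] carries the singularity of [f] at 0 and is supported in ]0, a]; [fb] is
   continuous on the whole line. In a convolution the former is integrated
   against values of the other factor away from 0. *)
Lemma causal_cutoff f a : 0 < a -> causal f ->
  exists fs fb : R -> R, [/\ forall x, f x = fb x + fs x, causal fs,
    forall x, a <= x -> fs x = 0, continuous fb & forall x, x <= 0 -> fb x = 0].
Proof.
move=> a0 [f0 cf intf]; have [chi [cchi chi1 chi0]] := continuous_cutoff a a0.
exists (fun x => chi x * f x), (fun x => (1 - chi x) * f x); split.
- by move=> x; ring.
- split.
  + by move=> t /f0 ->; rewrite mulr0.
  + by move=> t t0; apply: continuousM; [exact: cchi | exact: cf].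
  + move=> T; have [M M0 chiM] :=
      continuous_segment_bounded chi 0 T (fun x _ => cchi x).
    apply: (@integrableMr _ _ _ mu `]0, T[ _ chi (EFin \o f)) => //.
      by apply: measurable_funTS; exact: continuous_measurable_fun.
    exists M; split; first exact: num_real.
    move=> N MN s /=; rewrite in_itv/= => sb.
    by apply: (le_trans _ (ltW MN)); apply: chiM; lra.
- by move=> x /chi0 ->; rewrite mul0r.
- move=> x; have [x0|x0] := ltP 0 x.
    apply: (@continuousM R R (fun x => 1 - chi x) f x); last exact: cf.
    by apply: continuousB; [exact: cst_continuous | exact: cchi].
  (* Around [x <= 0] the factor [1 - chi] is identically zero, which removes a possible blow-up of
     [f] at 0. *)
  apply: (@near_cst_continuous _ _ 0); near=> y.
  rewrite chi1 ?subrr ?mul0r//; apply: ltW; near: y.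
  by apply: lt_nbhsl; lra.
- by move=> x /f0 ->; rewrite mulr0.
Unshelve. all: by end_near. Qed.

(** * Existence, continuity and local integrability of convolutions *)

Lemma near_eq_continuous f g (x : R) : (\forall y \near x, f y = g y) ->
  {for x, continuous g} -> {for x, continuous f}.
Proof.
move=> fg; rewrite /prop_for /continuous_at (nbhs_singleton fg) => cg.
by apply: (cvg_trans _ cg); apply: near_eq_cvg; near=> y; apply/esym; near: y.
Unshelve. all: by end_near. Qed.

(** Cut [f] at [t / 2]. The continuous part is bounded against [g]; for the singular part the roles
    are exchanged by reflection, and [g (t - u)] with [u < t / 2] is evaluated away from 0. *)
Lemma causal_conv_integrable f g t : causal f -> causal g ->
  mu.-integrable setT (fun s : R => (f (t - s) * g s)%:E).
Proof.
move=> cf cg; have [f0 _ _] := cf; have [g0 cg' ig] := cg.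
have [t0|t0] := leP t 0.
  apply/(integrable_support (fun s => f (t - s) * g s) `]0, t[) => //.
    by move=> s; exact: mul_reflect_support.
  by rewrite set_itv_ge ?bnd_simp -?leNgt//; exact: integrable_set0.
have t20 : 0 < t / 2 by lra.
have [fs [fb [fE cfs fs0 cfb fb0]]] := causal_cutoff f (t / 2) t20 cf.
have [fs0' _ ifs] := cfs.
have -> : (fun s : R => (f (t - s) * g s)%:E) =
    (fun s : R => (fb (t - s) * g s)%:E) \+
    (fun s : R => (fs (t - s) * g s)%:E).
  by apply/funext => s /=; rewrite -EFinD -mulrDl -fE.
apply: integrableD => //.
  apply/(integrable_support (fun s => fb (t - s) * g s) `]0, t[) => //.
    by move=> s; exact: mul_reflect_support.
  apply: moving_kernel_integrable => // y _; exact: cfb.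
have -> : (fun s : R => (fs (t - s) * g s)%:E) =
    (fun s : R => (fun u => (g (t - u) * fs u)%:E) (t - s)).
  by apply/funext => s /=; rewrite subKr mulrC.
apply: (integrable_reflect t (fun u => (g (t - u) * fs u)%:E)).
apply/(integrable_support (fun s => g (t - s) * fs s) `]0, (t / 2)[) => //.
  move=> s /=; rewrite in_itv/= => /negP; rewrite negb_and -!leNgt.
  by move=> /orP[/fs0'|/fs0] ->; rewrite mulr0.
by apply: moving_kernel_integrable => // y yt; apply: cg'; lra.
Qed.

Lemma causal_conv_continuous f g t : causal f -> causal g -> 0 < t ->
  {for t, continuous (conv f g)}.
Proof.
move=> cf cg t0; have [f0 _ _] := cf; have [g0 cg' ig] := cg.
(* For [t / 2 < y] and [s < t / 3], the argument [y - s] exceeds [t / 6], so [g] is continuous at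
   every point used in [S2]. *)
have t30 : 0 < t / 3 by lra.
have [fs [fb [fE cfs fs0 cfb fb0]]] := causal_cutoff f (t / 3) t30 cf.
have [fs0' _ ifs] := cfs.
(* Both domains are independent of [x], which then moves only inside the integrand, as
   [moving_kernel_continuous] requires. *)
pose S1 x := \int[mu]_(s in `]0, (2 * t)[) (fb (x - s) * g s).
pose S2 x := \int[mu]_(s in `]0, (t / 3)[) (g (x - s) * fs s).
have near_t : \forall y \near t, t / 2 < y < 2 * t.
  near=> y; apply/andP; split; near: y.
    by apply: lt_nbhsr; lra.
  by apply: lt_nbhsl; lra.
apply: (near_eq_continuous _ (S1 \+ S2)); last first.
  apply: continuousD.
    apply: (moving_kernel_continuous _ _ (t / 2) (2 * t)); [|exact: ig|lra].
    by move=> y _; exact: cfb.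
  apply: (moving_kernel_continuous _ _ (t / 2) (2 * t)); [|exact: ifs|lra].
  by move=> y yt; apply: cg'; lra.
near=> y.
have /andP[y1 y2] : t / 2 < y < 2 * t by near: y.
have fbg s : ~ `]0, (2 * t)[%classic s -> fb (y - s) * g s = 0.
  by apply: mul_reflect_support => //; lra.
have gfs s : ~ `]0, (t / 3)[%classic s -> g (y - s) * fs s = 0.
  move=> /=; rewrite in_itv/= => /negP; rewrite negb_and -!leNgt.
  by move=> /orP[/fs0'|/fs0] ->; rewrite mulr0.
have i1 : mu.-integrable setT (fun s : R => (fb (y - s) * g s)%:E).
  apply/(integrable_support (fun s => fb (y - s) * g s) `]0, (2 * t)[) => //.
  by apply: moving_kernel_integrable => // x _; exact: cfb.
have i2 := causal_conv_integrable _ _ y cfs cg.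
rewrite conv_setT//= /S1 /S2 (Rintegral_support (fun s => fb (y - s) * g s))//.
rewrite (Rintegral_support (fun s => g (y - s) * fs s))// -(conv_setT g)//.
rewrite (conv_comm g fs)// conv_setT// -RintegralD//.
by apply: eq_Rintegral => s _; rewrite fE mulrDl.
Unshelve. all: by end_near. Qed.

(** Passing to globally integrable functions gives access to Fubini on the whole plane; on []0, T[]
    the convolution of the truncations is unchanged. *)
Lemma causal_truncate f T : causal f ->
  [/\ measurable_fun setT (f \_ `]0, T[),
      mu.-integrable setT (EFin \o f \_ `]0, T[) &
      forall t, t < T -> (f \_ `]0, T[) t = f t].
Proof.
move=> cf; have [f0 _ intf] := cf; split.
- apply/(measurable_restrictT f) => //.
  exact: measurable_funTS (causal_measurable f cf).
- rewrite -restrict_EFin.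
  apply/(@integrable_mkcond _ _ R mu `]0, T[ (EFin \o f) (measurable_itv _)).
  exact: intf.
- move=> t tT; rewrite patchE; case: ifPn => // /negP.
  rewrite inE/= in_itv/= tT andbT.
  by move/negP; rewrite -leNgt => /f0.
Qed.

(** Tonelli with the [x]-integral inside: by translation invariance it equals the L1 norm of [f]
    times [|g y|], and the total is the product of the two norms. *)
Lemma integrable_conv_product (f g : R -> R) :
  measurable_fun setT f -> measurable_fun setT g ->
  mu.-integrable setT (EFin \o f) -> mu.-integrable setT (EFin \o g) ->
  (mu \x mu)%E.-integrable setT (fun x : R * R => (f (x.1 - x.2) * g x.2)%:E).
Proof.
move=> mf mg /integrableP[_ iF] /integrableP[_ iG].
have mfg : measurable_fun setT (fun x : R * R => (f (x.1 - x.2) * g x.2)%:E).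
  apply/measurable_EFinP; apply: measurable_funM.
    by apply: (measurableT_comp mf); exact: measurable_funB.
  exact: (measurableT_comp mg).
apply/(@integrable21ltyP _ _ _ _ R mu mu _ mfg).
rewrite (eq_integral (fun y : measurableTypeR R =>
    (\int[mu]_x `|(f x)%:E|) * `|(g y)%:E|)%E); last first.
  move=> y _.
  rewrite -(integral_shift y (fun x => `|(f x)%:E|%E)); last first.
    by apply: measurableT_comp => //; exact/measurable_EFinP.
  rewrite -ge0_integralZr//.
  - by apply: eq_integral => x _; rewrite -abseM.
  - apply: measurableT_comp => //; apply/measurable_EFinP.
    by apply: (measurableT_comp mf); exact: measurable_funB.
rewrite ge0_integralZl//.
- apply: lte_mul_pinfty; [exact: integral_ge0 | | exact: iG].
  by rewrite ge0_fin_numE ?integral_ge0//; exact: iF.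
- by apply: measurableT_comp => //; exact/measurable_EFinP.
- exact: integral_ge0.
Qed.

Lemma causal_conv f g : causal f -> causal g -> causal (conv f g).
Proof.
move=> cf cg; have [f0 _ _] := cf; have [g0 _ _] := cg; split.
- by move=> t; exact: conv_le0.
- by move=> t; exact: causal_conv_continuous.
move=> T.
have [mfT ifT fTE] := causal_truncate f T cf.
have [mgT igT gTE] := causal_truncate g T cg.
(* The marginal in the first variable is the convolution of the truncations, hence integrable by
   Fubini. *)
have iF := integrable_fubini_F (integrable_conv_product _ _ mfT mgT ifT igT).
have := @integrableS _ (measurableTypeR R) R mu setT `]0, T[ _ measurableT
  (measurable_itv _) (@subsetT _ _) iF.
apply: eq_integrable => // t /[!inE]/=; rewrite in_itv/= => /andP[t0 tT].
(* Both sides vanish unless [0 < s < t], and there [s] and [t - s] lie below [T]. *)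
have E s : (f \_ `]0, T[) (t - s) * (g \_ `]0, T[) s = f (t - s) * g s.
  have [s0|s0] := leP s 0.
    by rewrite g0// [X in _ * X](_ : _ = 0) ?mulr0// patchE g0//; case: ifP.
  have [st|st] := ltP s t; first by rewrite fTE ?gTE//; lra.
  rewrite f0; last by lra.
  by rewrite mul0r [X in X * _](_ : _ = 0) ?mul0r// patchE f0 ?if_same//; lra.
rewrite /fubini_F.
rewrite (eq_integral (fun s : measurableTypeR R =>
    (f (t - s) * g s)%:E)); last first.
  by move=> s _; rewrite /= E.
rewrite /= conv_setT// /Rintegral fineK//; apply: integrable_fin_num => //.
exact: causal_conv_integrable.
Qed.

Lemma causal_norm f : causal f -> causal (fun x => `|f x|).
Proof.
move=> [f0 cf intf]; split.
- by move=> t /f0 ->; rewrite normr0.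
- move=> t t0; apply: (@continuous_comp _ _ _ f (@Num.norm _ R)).
    exact: cf.
  exact: norm_continuous.
- by move=> T; apply: integrable_norm.
Qed.

(** * Associativity of the convolution *)

Lemma eq_conv f f' g g' t : (forall s, 0 < s -> f s = f' s) ->
  (forall s, 0 < s -> g s = g' s) -> conv f g t = conv f' g' t.
Proof.
move=> ff' gg'; apply: eq_Rintegral => s /[!inE]/=; rewrite in_itv/= => st.
by rewrite ff' ?gg'//; lra.
Qed.

Lemma EFin_conv f g t : causal f -> causal g ->
  (conv f g t)%:E = (\int[mu]_s (f (t - s) * g s)%:E)%E.
Proof.
move=> cf cg; have [f0 _ _] := cf; have [g0 _ _] := cg.
rewrite conv_setT// /Rintegral fineK//; apply: integrable_fin_num => //.
exact: causal_conv_integrable.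
Qed.

Lemma integral_conv_r f g t (a : R) : causal f -> causal g ->
  (\int[mu]_s (a * (f (t - s) * g s))%:E)%E = (a * conv f g t)%:E.
Proof.
move=> cf cg; rewrite EFinM EFin_conv// -integralZl//.
exact: causal_conv_integrable.
Qed.

(** The shift [u -> u - s] turns the integral into the convolution at [t - s]. *)
Lemma integral_conv_l f g t s (a : R) : causal f -> causal g ->
  (\int[mu]_u (f (t - u) * g (u - s) * a)%:E)%E = (conv f g (t - s) * a)%:E.
Proof.
move=> cf cg; rewrite mulrC -integral_conv_r//.
rewrite -(integral_shift s (fun u => (a * (f (t - s - u) * g u))%:E)).
  apply: eq_integral => u _; congr EFin; rewrite mulrC.
  by congr (_ * (f _ * _)); ring.
apply/measurable_EFinP; apply: measurable_funM => //.
by apply: measurable_mul_reflect; exact: causal_measurable.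
Qed.

(** Both sides are iterated integrals of [K]. Integrating [|K|] in [s] first leaves [|f (t - u)|]
    times the convolution of [|g|] and [|h|] at [u]; that convolution is causal, so the result is
    integrable in [u] and Fubini applies. *)
Lemma conv_assoc f g h : causal f -> causal g -> causal h ->
  conv (conv f g) h = conv f (conv g h).
Proof.
move=> cf cg ch; apply/funext => t.
pose K (x : R * R) : \bar R := (f (t - x.1) * g (x.1 - x.2) * h x.2)%:E.
have mK : measurable_fun setT K.
  apply/measurable_EFinP; apply: measurable_funM.
    apply: measurable_funM.
      apply: (measurableT_comp (causal_measurable f cf)).
      exact: (measurableT_comp (measurable_reflect t)).
    apply: (measurableT_comp (causal_measurable g cg)).
    exact: measurable_funB.
  exact: (measurableT_comp (causal_measurable h ch)).
have [caf cag cah] :=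
  And3 (causal_norm f cf) (causal_norm g cg) (causal_norm h ch).
have iK : (mu \x mu)%E.-integrable setT K.
  apply/(@integrable12ltyP _ _ _ _ R mu mu _ mK).
  rewrite (eq_integral (fun u : measurableTypeR R => (`|f (t - u)| *
    conv (fun x => `|g x|) (fun x => `|h x|) u)%:E)); last first.
    move=> u _; rewrite -integral_conv_r//.
    by apply: eq_integral => s _; rewrite /K /= !normrM mulrA.
  apply: integrable_lty => //.
  apply: (causal_conv_integrable (fun x => `|f x|)) => //.
  exact: causal_conv.
have cfg := causal_conv f g cf cg; have cgh := causal_conv g h cg ch.
apply: EFin_inj; rewrite !EFin_conv//.
(* The left side integrates in [u] first, the right side in [s] first. *)
transitivity (\int[mu]_s \int[mu]_u K (u, s))%E.
  by apply: eq_integral => s _; rewrite -integral_conv_l.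
rewrite -Fubini//; apply: eq_integral => u _.
rewrite -integral_conv_r//.
by apply: eq_integral => s _; rewrite /K /= mulrA.
Qed.

Lemma conv_left_comm f g h : causal f -> causal g -> causal h ->
  conv f (conv g h) = conv g (conv f h).
Proof.
move=> cf cg ch; rewrite -(conv_assoc f g h cf cg ch) (conv_comm f g cf cg).
exact: conv_assoc.
Qed.

(** * Integrability of powers at 0 and the embedding of C_{-1} in the causal class *)

Lemma powR_continuous_gt0 (p x : R) :
  0 < x -> {for x, continuous (@powR R ^~ p)}.
Proof.
move=> x0; apply: differentiable_continuous; apply/derivable1_diffP.
by apply: derivable_powR; rewrite in_itv/= x0.
Qed.

Lemma is_derive_powR_primitive (p x : R) : -1 < p -> 0 < x ->
  is_derive x 1 (fun x : R => (p + 1)^-1 * x `^ (p + 1)) (x `^ p).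
Proof.
move=> p1 x0; have p10 : p + 1 != 0 by rewrite gt_eqF//; lra.
have -> : x `^ p = (p + 1)^-1 *: ((p + 1) * x `^ (p + 1 - 1)).
  by rewrite addrK scalerA mulVf// scale1r.
have H := is_derive1_powR (p + 1) x0.
by have := is_deriveZ (p + 1)^-1 H.
Qed.

Lemma integral_powR (p a b : R) : -1 < p -> 0 < a < b ->
  (\int[mu]_(x in `[a, b]) (x `^ p)%:E)%E =
  ((b `^ (p + 1) - a `^ (p + 1)) / (p + 1))%:E.
Proof.
move=> p1 /andP[a0 ab]; have p10 : p + 1 != 0 by rewrite gt_eqF//; lra.
pose F (x : R) := (p + 1)^-1 * x `^ (p + 1).
have cF (x : R) : 0 < x -> {for x, continuous F}.
  move=> x0; apply: continuousM; first exact: cst_continuous.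
  exact: powR_continuous_gt0.
have H1 : {within `[a, b], continuous (fun x : R => x `^ p)}.
  apply: continuous_in_subspaceT => x /[!inE]/=; rewrite in_itv/= => xab.
  by apply: powR_continuous_gt0; lra.
have H2 : derivable_oo_LRcontinuous F a b.
  split.
  + move=> x; rewrite in_itv/= => xab.
    by have [|//] := is_derive_powR_primitive p x p1; lra.
  + by apply: cvg_at_right_filter; exact: cF.
  + by apply: cvg_at_left_filter; apply: cF; lra.
have H3 : {in `]a, b[, derive1 F =1 (fun x : R => x `^ p)}.
  move=> x; rewrite in_itv/= => xab; rewrite derive1E.
  by have [|_ ->] := is_derive_powR_primitive p x p1; first lra.
have H := continuous_FTC2 ab H1 H2 H3.
by rewrite H -EFinB; congr EFin; rewrite /F; field.
Qed.

(** Monotone convergence along segments exhausting []0, T]]: each integral is at most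
    [T^(p+1) / (p+1)], the contribution of the lower end point being subtracted. *)
Lemma powR_integrable (p T : R) :
  -1 < p -> mu.-integrable `]0, T[ (EFin \o @powR R ^~ p).
Proof.
move=> p1.
have [T0|T0] := leP T 0.
  by rewrite set_itv_ge ?bnd_simp -?leNgt//; exact: integrable_set0.
(* With [n.+2] the lower end point is strictly below [T] even at [n = 0], as [integral_powR]
   demands. *)
pose F (n : nat) : set R := `[T / n.+2%:R, T]%classic.
have FE : \bigcup_n F n = `]0, T]%classic.
  apply/seteqP; split=> [x [n _]|x].
    rewrite /F /= !in_itv/= => /andP[x1 ->].
    by rewrite andbT (lt_le_trans _ x1)// divr_gt0.
  rewrite /= in_itv/= => /andP[x0 xT].
  exists (Num.truncn (T / x)) => //.
  rewrite /F /= in_itv/= xT andbT ler_pdivrMr//.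
  rewrite mulrC -ler_pdivrMr// ltW//.
  by rewrite (lt_trans (truncnS_gt _))// ltr_nat.
have mp : measurable_fun `]0, T] (EFin \o @powR R ^~ p).
  by apply/measurable_EFinP; apply: measurable_funTS; exact: measurable_powR.
suff : mu.-integrable `]0, T] (EFin \o @powR R ^~ p).
  apply: integrableS => //; exact: subset_itv_oo_oc.
apply/integrableP; split => //.
under eq_integral do rewrite /= ger0_norm ?powR_ge0//.
rewrite -FE.
have Fcvg : (\int[mu]_(x in F n) (x `^ p)%:E)%E @[n --> \oo] -->
    (\int[mu]_(x in \bigcup_n F n) (x `^ p)%:E)%E.
  apply: ge0_nondecreasing_set_cvg_integral => //.
  - apply/nondecreasing_seqP => n; rewrite subsetEset; apply: subset_itvr.
    by rewrite bnd_simp ler_pM2l// lef_pV2 ?posrE// ler_nat.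
  - by move=> n; exact: measurable_itv.
  - move=> n; apply/measurable_EFinP.
    by apply: measurable_funTS; exact: measurable_powR.
  - by move=> n x _; rewrite lee_fin powR_ge0.
apply: (@le_lt_trans _ _ (T `^ (p + 1) / (p + 1))%:E); last by rewrite ltry.
rewrite -(cvg_lim _ Fcvg)//.
apply: lime_le; first by apply/cvg_ex; eexists; exact: Fcvg.
near=> n; rewrite /F integral_powR//; last first.
  by rewrite divr_gt0//= ltr_pdivrMr// ltr_pMr// ltr1n.
rewrite lee_fin ler_pM2r ?invr_gt0; last by lra.
by rewrite lerBlDr lerDl powR_ge0.
Unshelve. all: by end_near. Qed.

(** This is the extension by zero from []0, +oo[], not the maximum of [f] and 0. *)
Definition pos_part f t : R := if 0 < t then f t else 0.

Lemma pos_partE f t : 0 < t -> pos_part f t = f t.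
Proof. by rewrite /pos_part => ->. Qed.

(** Near 0, [f] is the product of the integrable [x^p] and a factor bounded on [[0, T]] by
    compactness. *)
Lemma Cm1_causal f : Cm1 f -> causal (pos_part f).
Proof.
move=> [p [f1 [p1 cf1 fE]]].
have cf1' t : 0 < t -> {for t, continuous f1}.
  move=> t0; have [+ _] := (continuous_within_itvcyP _ _).1 cf1.
  by apply; rewrite in_itv/= t0.
split.
- by move=> t t0; rewrite /pos_part ltNge t0.
- move=> t t0; apply: (near_eq_continuous _ (fun x => x `^ p * f1 x)).
    near=> x; have x0 : 0 < x by near: x; exact: lt_nbhsr.
    by rewrite pos_partE// fE.
  by apply: continuousM; [exact: powR_continuous_gt0 | exact: cf1'].
- move=> T; have wf1 : {within `[0, T], continuous f1}.
    by apply: continuous_subspaceW cf1; apply: subset_itvl; rewrite bnd_simp.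
  have /compact_bounded[M [_ fM]] :=
    continuous_compact wf1 (@segment_compact R 0 T).
  have : mu.-integrable `]0, T[ ((EFin \o f1) \* (EFin \o @powR R ^~ p))%E.
    apply: integrableMr => //; last exact: powR_integrable.
      apply: open_continuous_measurable_fun => // x /[!inE]/=.
      rewrite in_itv/= => x0.
      by apply: cf1'; lra.
    exists M; split; first exact: num_real.
    move=> N MN s /=; rewrite in_itv/= => sb; apply: (fM N MN).
    by exists s => //=; rewrite in_itv/=; lra.
  apply: eq_integrable => // x /[!inE]/=; rewrite in_itv/= => /andP[x0 _].
  by rewrite pos_partE// fE// mulrC.
Unshelve. all: by end_near. Qed.

(** * One derivative undoes one integral *)

Lemma conv_exists_causal f f' g g' : causal f' -> causal g' ->
  (forall s, 0 < s -> f s = f' s) -> (forall s, 0 < s -> g s = g' s) ->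
  conv_exists f g.
Proof.
move=> cf cg ff' gg' t t0.
have := @integrableS _ (measurableTypeR R) R mu setT `]0, t[ _ measurableT
  (measurable_itv _) (@subsetT _ _) (causal_conv_integrable f' g' t cf cg).
apply: eq_integrable => // s /[!inE]/=; rewrite in_itv/= => st.
by rewrite ff' ?gg'//; lra.
Qed.

Lemma near_eq_derive1 f g t : (\forall y \near t, f y = g y) ->
  derivable g t 1 -> derivable f t 1 /\ derive1 f t = derive1 g t.
Proof.
move=> fg dg; split; last by rewrite !derive1E; exact: near_eq_derive.
have gf : \forall y \near t, g y = f y by near=> y; apply/esym; near: y.
exact: (near_eq_derivable gf dg).
Unshelve. all: by end_near. Qed.

(** Convolving with the constant 1 is integrating from 0, so the fundamental theorem of calculus
    applies at the continuity point [t]. *)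
Lemma derive1_conv_unit f g F t : (forall s, 0 < s -> g s = 1) -> causal f ->
  (forall s, 0 < s -> F s = conv g f s) -> 0 < t ->
  derivable F t 1 /\ derive1 F t = f t.
Proof.
move=> g1 cf FE t0; have [_ cf' intf] := cf.
have FG : \forall y \near t, F y = (\int[mu]_(s in [set` `]0, y]]) f s).
  near=> y; have y0 : 0 < y by near: y; exact: lt_nbhsr.
  rewrite FE// -Rintegral_itv_bndo_bndc; last exact: intf.
  apply: eq_Rintegral => s /[!inE]/=; rewrite in_itv/= => sy.
  by rewrite g1 ?mul1r//; lra.
have tt1 : t < t + 1 by rewrite ltrDl.
(* The end point [t + 1] only leaves room to the right of [t]; []0, t + 1]] lies in the open []0, t
   + 2[], where integrability is known. *)
have [|||] := @continuous_FTC1 R f (BRight 0) t (t + 1) tt1.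
- apply: (integrableS _ _ _ (intf (t + 2))) => //.
  by apply: subset_itvl; rewrite bnd_simp; lra.
- by [].
- exact: cf'.
move=> dG G'; rewrite -G'; exact: near_eq_derive1.
Unshelve. all: by end_near. Qed.

(** The primed functions are causal representatives of the kernels. The lemma also records that
    every operation in the derivative is well defined, which total operators do not ensure. *)
Lemma gfd1_left_inverse (kappa k1 k2 kappa' k1' k2' phi G : R -> R) :
  causal kappa' -> causal k1' -> causal k2' -> causal phi ->
  (forall t, 0 < t -> k1 t = k1' t) -> (forall t, 0 < t -> k2 t = k2' t) ->
  (forall t, 0 < t -> conv (conv kappa' k1') k2' t = 1) ->
  (forall t, 0 < t -> G t = conv k1' (conv kappa' phi) t) ->
  gfd1_exists k1 k2 G /\ forall t, 0 < t -> gfd1 k1 k2 G t = conv k1' phi t.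
Proof.
move=> ck c1 c2 cphi k1E k2E hK GE.
have ckphi := causal_conv kappa' phi ck cphi.
have ck1 := causal_conv kappa' k1' ck c1.
have DG t : 0 < t -> derivable (gfi k2 G) t 1 /\ derive1 (gfi k2 G) t = phi t.
  apply: (derive1_conv_unit phi _ _ t hK cphi) => s s0.
  rewrite /gfi (eq_conv _ k2' _ (conv k1' (conv kappa' phi)))//.
  have c1phi := causal_conv k1' phi c1 cphi.
  have c2phi := causal_conv k2' phi c2 cphi.
  (* Both sides are brought to the common form in which [kappa'], [k1'], [k2'] are applied to [phi]
     from the outside in. *)
  rewrite (conv_assoc _ k2' phi ck1 c2 cphi) (conv_assoc _ _ _ ck c1 c2phi).
  rewrite (conv_left_comm k1' _ _ c1 ck cphi).
  rewrite (conv_left_comm k2' _ _ c2 ck c1phi).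
  by rewrite (conv_left_comm k2' _ _ c2 c1 cphi).
split; first split.
- apply: (conv_exists_causal _ k2' _ (conv k1' (conv kappa' phi))) => //.
  exact: causal_conv.
- by move=> t /DG[].
- by apply: (conv_exists_causal _ k1' _ phi) => // s /DG[].
- by move=> t t0; apply: eq_conv => // s /DG[].
Qed.

End convolution.

(** * Induction over the n-fold operators *)

Theorem theorem3 (R : realType) (kappa k1 k2 : R -> R) (n : nat)
    (hK : first_level_kernels (kappa, k1, k2))
    (f : R -> R) (hf : gfi_range k1 f) :
  [/\ (* every step of the n-fold GFI, then of the n-fold GFD, is well defined *)
      forall j : nat, (j < n)%N -> conv_exists kappa (gfi_iter kappa j f),
      forall j : nat, (j < n)%N ->
        gfd1_exists k1 k2 (gfd1_iter k1 k2 j (gfi_iter kappa n f)) &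
      forall t : R, 0 < t ->
        gfd1_iter k1 k2 n (gfi_iter kappa n f) t = f t].
Proof.
have [Ck C1 C2 hK1] := hK; have [phi Cphi fE] := hf.
have [ck c1 c2 cphi] := And4 (Cm1_causal kappa Ck) (Cm1_causal k1 C1)
  (Cm1_causal k2 C2) (Cm1_causal phi Cphi).
have hK1' t : 0 < t ->
    conv (conv (pos_part kappa) (pos_part k1)) (pos_part k2) t = 1.
  move=> t0; rewrite -[RHS](hK1 t t0).
  apply: eq_conv => s s0; last exact: pos_partE.
  by apply: eq_conv => u u0; exact: pos_partE.
pose psi j := iter j (conv (pos_part kappa)) (pos_part phi).
have cpsi j : causal (psi j) by elim: j => //= j; exact: causal_conv.
have IE j t : 0 < t -> gfi_iter kappa j f t = conv (pos_part k1) (psi j) t.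
  elim: j t => [|j IH] t t0 /=.
    by rewrite fE//; apply: eq_conv => s s0; rewrite pos_partE.
  (* Moving [kappa] outside [k1] exposes the previous iterate. *)
  rewrite conv_left_comm//; apply: eq_conv => s s0; last exact: IH.
  by rewrite pos_partE.
have step j G : (forall t, 0 < t -> G t = conv (pos_part k1) (psi j.+1) t) ->
    gfd1_exists k1 k2 G /\
    forall t, 0 < t -> gfd1 k1 k2 G t = conv (pos_part k1) (psi j) t.
  by apply: gfd1_left_inverse hK1' => // t t0; rewrite pos_partE.
have DE j t : (j <= n)%N -> 0 < t ->
    gfd1_iter k1 k2 j (gfi_iter kappa n f) t =
    conv (pos_part k1) (psi (n - j)%N) t.
  elim: j t => [|j IH] t jn t0; first by rewrite subn0; exact: IE.
  apply: (step (n - j.+1)%N _ _).2 => // s s0.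
  (* Here [(n - j.+1).+1 = n - j] relies on [j < n], since subtraction is truncated. *)
  by rewrite subnSK//; apply: IH => //; exact: ltnW.
split.
- move=> j _; apply: (conv_exists_causal _ _ _ (conv (pos_part k1) (psi j)) ck).
  + exact: causal_conv.
  + by move=> s s0; rewrite pos_partE.
  + exact: IE.
- move=> j jn; apply: (step (n - j.+1)%N _ _).1 => t t0.
  by rewrite subnSK//; apply: DE => //; exact: ltnW.
(* After [n] derivatives [psi 0] remains, and [IE] at index 0 is the representation of [f]
   itself. *)
- by move=> t t0; rewrite DE// subnn; exact/esym/(IE 0).
Qed.
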